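(* Assume that there is a constant $V\in(0,+\infty)$ such that $\max_{1\le i\le n}\mathbb E[\|\varepsilon_i\|_{\mathcal H}^2]\le V$, and that $D^\star\ge2$. For $\delta_n,y>0$ define $$v_2(y,\delta_n):=24\,(D^\star)^2\,\frac{\overline\Delta\sqrt V}{\underline\Delta^2}\,\frac{y}{\sqrt n}+8\,D^\star\,\frac{V}{\underline\Delta^2}\,\frac{y^2}{n\,\delta_n}.$$ For every $y>0$ there exists an event $\Omega_2$ with $\mathbb P(\Omega_2)\ge 1-\frac1{y^2}$ on which the following holds: for every $\delta_n\in(0,\underline\Lambda_{\tau^\star}]$ and every $$\widehat\tau(D^\star,\delta_n)\in\operatorname*{arg\,min}\big\{\widehat{\mathcal R}_n(\tau):\ \tau\in\mathcal T_n,\ D_\tau=D^\star,\ \underline\Lambda_\tau\ge\delta_n\big\},$$ if $v_2(y,\delta_n)\le\underline\Lambda_{\tau^\star}$, then $$\frac1n\,d_\infty^{(1)}\big(\tau^\star,\widehat\tau(D^\star,\delta_n)\big)\le v_2(y,\delta_n).$$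
   Context: Setting. Let $2\le n<+\infty$, let $\mathcal X$ be a measurable space and $X_1,\dots,X_n$ independent $\mathcal X$-valued random variables (not necessarily identically distributed). Let $k:\mathcal X\times\mathcal X\to\mathbb R$ be a measurable (symmetric) positive semidefinite kernel, $\mathcal H$ its reproducing kernel Hilbert space, assumed separable, with norm $\|\cdot\|_{\mathcal H}$ and feature map $\Phi(x)=k(\cdot,x)$. Assume $\mathbb E[\sqrt{k(X_i,X_i)}]<\infty$ for all $i$. Put $Y_i=\Phi(X_i)$, let $\mu^\star_i\in\mathcal H$ be the Bochner expectation of $Y_i$, and $\varepsilon_i=Y_i-\mu^\star_i$. Segmentations. For integers $0=\tau_0<\tau_1<\dots<\tau_D=n$ with $1\le D\le n$, the segmentation $\tau=[\tau_0,\dots,\tau_D]$ of $\{1,\dots,n\}$ is the collection of segments $\{\tau_{\ell-1}+1,\dots,\tau_\ell\}$, $1\le\ell\le D$; $D_\tau:=D$ is its number of segments; $\mathcal T_n$ is the set of all segmentations. True segmentation. $\tau^\star\in\mathcal T_n$, with $D^\star:=D_{\tau^\star}$ segments, is the unique segmentation such that $i\mapsto\mu^\star_i$ is constant on each segment of $\tau^\star$ and takes different values on any two consecutive segments of $\tau^\star$. Empirical risk: $$\widehat{\mathcal R}_n(\tau)=\frac1n\sum_{i=1}^n k(X_i,X_i)-\frac1n\sum_{\ell=1}^{D_\tau}\Big[\frac1{\tau_\ell-\tau_{\ell-1}}\sum_{i=\tau_{\ell-1}+1}^{\tau_\ell}\ \sum_{j=\tau_{\ell-1}+1}^{\tau_\ell}k(X_i,X_j)\Big].$$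 Other notation: $\underline\Delta:=\min\{\|\mu^\star_i-\mu^\star_{i+1}\|_{\mathcal H}: 1\le i\le n-1,\ \mu^\star_i\ne\mu^\star_{i+1}\}$; $\overline\Delta:=\max_{1\le i\le n-1}\|\mu^\star_i-\mu^\star_{i+1}\|_{\mathcal H}$; $\underline\Lambda_\tau:=\frac1n\min_{1\le\ell\le D_\tau}(\tau_\ell-\tau_{\ell-1})$; for $\tau^1,\tau^2\in\mathcal T_n$ with at least two segments, $$d_\infty^{(1)}(\tau^1,\tau^2):=\max_{1\le i\le D_{\tau^1}-1}\ \min_{1\le j\le D_{\tau^2}-1}|\tau^1_i-\tau^2_j|.$$ *)

(* Defs.v *)
From HB Require Import structures.
From mathcomp Require Import all_boot all_order all_algebra sesquilinear.
From mathcomp Require Import all_classical all_reals all_analysis.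

Set Implicit Arguments.
Unset Strict Implicit.
Unset Printing Implicit Defensive.

Import Order.TTheory GRing.Theory Num.Theory.
Import numFieldNormedType.Exports.

Local Open Scope classical_set_scope.
Local Open Scope ring_scope.

Section Segmentations.
Variable n : nat.

(* [:: tau_0; ...; tau_D] with 0 = tau_0 < ... < tau_D = n and D >= 1;
   D <= n follows. *)
Definition is_segmentation (t : seq nat) : bool :=
  [&& (1 < size t)%N, nth 0%N t 0 == 0%N, last 0%N t == n & sorted ltn t].

Record segmentation := Segmentation {
  breakpoints :> seq nat;
  breakpointsP : is_segmentation breakpoints
}.

Definition breakpoint (t : segmentation) (l : nat) : nat :=
  nth 0%N (breakpoints t) l.

Definition nseg (t : segmentation) : nat := (size t).-1.

(* For l < nseg t, the set {tau_l + 1, ..., tau_(l+1)} with its elements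
   shifted down by one: the indices 1, ..., n are the elements 0, ..., n - 1
   of 'I_n. *)
Definition segment (t : segmentation) (l : nat) : {set 'I_n} :=
  [set i : 'I_n | (breakpoint t l <= i < breakpoint t l.+1)%N]%SET.

Definition seg_length (t : segmentation) (l : nat) : nat :=
  (breakpoint t l.+1 - breakpoint t l)%N.

(* No length exceeds n, so starting the minimum at n is harmless. *)
Definition Lambda_min (R : realType) (t : segmentation) : R :=
  (\big[minn/n]_(l < nseg t) seg_length t l)%:R / n%:R.

(* Meaningful when both segmentations have at least two segments. No distance
   exceeds n, so starting the minimum at n is harmless. *)
Definition d_infty1 (t1 t2 : segmentation) : nat :=
  \max_(1 <= i < nseg t1)
    \big[minn/n]_(1 <= j < nseg t2)
      `|breakpoint t1 i - breakpoint t2 j|%N.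

Definition is_true_segmentation (E : Type) (mu : 'I_n -> E)
    (t : segmentation) : Prop :=
  (forall (l : nat) (i j : 'I_n), (l < nseg t)%N ->
     i \in segment t l -> j \in segment t l -> mu i = mu j) /\
  (forall (l : nat) (i j : 'I_n), (l.+1 < nseg t)%N ->
     i \in segment t l -> j \in segment t l.+1 -> mu i <> mu j).

End Segmentations.

Definition is_argmin (R : realType) (A : Type) (S : set A) (f : A -> R)
  (a : A) : Prop := S a /\ forall b, S b -> f a <= f b.

Section Kernels.
Variables (R : realType) (U : Type) (k : U -> U -> R).

Definition kernel_symmetric : Prop := forall x y, k x y = k y x.

Definition kernel_psd : Prop :=
  forall (m : nat) (x : 'I_m -> U) (c : 'I_m -> R),
    0 <= \sum_(i < m) \sum_(j < m) c i * c j * k (x i) (x j).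

(* The elements of H are identified with real functions on U through the
   injective linear map ev; Phi is the feature map x |-> k (., x). *)
Record is_rkhs (H : completeNormedModType R) (ip : {dot H for @idfun R})
    (ev : H -> U -> R) (Phi : U -> H) : Prop := IsRkhs {
  rkhs_norm : forall f, ip f f = `|f| ^+ 2;
  rkhs_linear : forall a f g x, ev (a *: f + g) x = a * ev f x + ev g x;
  rkhs_inj : injective ev;
  rkhs_feature : forall x z, ev (Phi x) z = k z x;
  rkhs_reproducing : forall f x, ev f x = ip f (Phi x)
}.

Definition empirical_risk (n : nat) (x : 'I_n -> U) (t : segmentation n) : R :=
  n%:R^-1 * (\sum_(i < n) k (x i) (x i))
  - n%:R^-1 * \sum_(l < nseg t)
      ((seg_length t l)%:R^-1 *
       \sum_(i in segment t l) \sum_(j in segment t l) k (x i) (x j)).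

End Kernels.

Definition separable_space (E : topologicalType) : Prop :=
  exists S : set E, countable S /\ dense S.

Definition independent_variables (R : realType) (n : nat) (d : measure_display)
    (T : measurableType d) (P : probability T R) (d' : measure_display)
    (U : measurableType d') (X : 'I_n -> T -> U) : Prop :=
  forall (J : {set 'I_n}) (A : 'I_n -> set U), (forall i, measurable (A i)) ->
    P (\bigcap_(i in [set` J]) (X i @^-1` A i)) =
    (\prod_(i in J) P (X i @^-1` A i))%E.

Section Bochner.
Variables (R : realType) (d : measure_display) (T : measurableType d).
Variables (P : probability T R) (H : completeNormedModType R).

Definition simple_function (s : T -> H) : Prop :=
  finite_set (range s) /\ forall h, measurable (s @^-1` [set h]).

Definition simple_expectation (s : T -> H) : H :=
  \sum_(h \in range s) fine (P (s @^-1` [set h])) *: h.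

(* The almost sure convergence is the strong measurability of f. It has to be
   required: the library's integral of a nonnegative function that is not
   measurable is a lower integral. *)
Definition is_bochner_expectation (f : T -> H) (m : H) : Prop :=
  exists s : nat -> T -> H,
    [/\ forall j, simple_function (s j),
        {ae P, forall w, s j w @[j --> \oo] --> f w},
        (\int[P]_w (`|f w - s j w|)%:E)%E @[j --> \oo] --> 0%E
      & simple_expectation (s j) @[j --> \oo] --> m].

Definition bochner_expectation (f : T -> H) : H :=
  xget 0 [set m | is_bochner_expectation f m].

End Bochner.

Section Jumps.
Variables (R : realType) (n : nat) (H : normedModType R) (mu : 'I_n -> H).

Definition Delta_max : R :=
  \big[Num.max/0]_(p : 'I_n * 'I_n | p.2 == p.1.+1 :> nat)
    `|mu p.1 - mu p.2|.

(* A minimum over a nonempty set as soon as mu is not constant; every term is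
   at most Delta_max, so starting the minimum there is harmless. *)
Definition Delta_min : R :=
  \big[Num.min/Delta_max]_(p : 'I_n * 'I_n |
      (p.2 == p.1.+1 :> nat) && (mu p.1 != mu p.2))
    `|mu p.1 - mu p.2|.

Definition v2 (Dstar : nat) (V y delta : R) : R :=
  24 * Dstar%:R ^+ 2 * (Delta_max * Num.sqrt V / Delta_min ^+ 2)
    * (y / Num.sqrt n%:R)
  + 8 * Dstar%:R * (V / Delta_min ^+ 2) * (y ^+ 2 / (n%:R * delta)).

End Jumps.

(* Main.v *)
Require Import Defs.
From HB Require Import structures.
From mathcomp Require Import all_boot all_order all_algebra sesquilinear.
From mathcomp Require Import all_classical all_reals all_analysis.
From mathcomp Require Import measurable_realfun.
From mathcomp Require Import ring lra zify.

(** With [Y i = mu i + eps i], minimizing the empirical risk over segmentations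
with a given number of segments amounts to maximizing the energy
[mean_pairing t Y Y], the sum over the segments of length times squared norm of
the mean of [Y].  Comparing the minimizer with the true segmentation, on whose
segments [mu] is constant, bounds the squared distance from [mu] to its
piecewise means by a term linear in the noise plus a term quadratic in the
noise ([residual_le]).

Both terms are controlled by the single number M, the largest norm of a partial
sum of the noise: the noise summed over a segment is a difference of two partial
sums.  Every value of [mu], hence every mean of values of [mu], is within
[D * Delta_max] of the first value, where D is the number of true segments, so
the linear term is at most [8 * D ^+ 2 * Delta_max * M]
([mean_pairing_noise_le]); the quadratic one is at most
[4 * D * M ^+ 2 / (n * delta)] ([mean_pairing_noise_sqr_le]).  Conversely, let m
be at most the length of every true segment, and suppose that some true change
point is at distance at least m from all the estimated ones.  Then the m points
on either side of it lie in one estimated segment and are fitted by one vector,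
which costs at least [m * Delta_min ^+ 2 / 2] ([residual_ge]).  For
[m = n * v2] and [M = y * sqrt (n * V)] this cost is exactly
[12 * D ^+ 2 * Delta_max * M + 4 * D * M ^+ 2 / (n * delta)]
([v2_noise_budget]), which the noise cannot pay.  The gap between 8 and 12 makes
the contradiction strict, as the boundary case [v2 = Lambda_min] requires
([change_point_localization]).

The event is [M < y * sqrt (n * V)]; its probability is bounded below by
Kolmogorov's maximal inequality in the Hilbert space
([kolmogorov_maximal]).  The point there is that each noise vector is orthogonal
in mean to any function of the past variables.  Since the mean of the noise is a
Bochner expectation, which has to be shown to exist
([bochner_expectation_pairing]), the noise has mean zero against every fixed
vector, and Fubini's theorem for the past sigma-algebra and the law of the next
variable ([decoupled_integral_eq0]) extends this to random vectors of the past.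
Measurability of all the inner products involved rests on the measurability of
every element of the reproducing kernel Hilbert space
([measurable_feature_ip]), which follows from an orthogonal projection. *)

Set Implicit Arguments.
Unset Strict Implicit.
Unset Printing Implicit Defensive.

Import Order.TTheory GRing.Theory Num.Theory.
Import numFieldNormedType.Exports.

Local Open Scope classical_set_scope.
Local Open Scope ring_scope.

Local Notation integ P f := (P.-integrable setT (EFin \o f)).

(** * Inner product spaces *)

Section InnerProduct.
Context (R : realType) (H : normedModType R) (ip : {dot H for @idfun R}).
Hypothesis ip_norm : forall f, ip f f = `|f| ^+ 2.

Lemma ipC u v : ip u v = ip v u.
Proof. by rewrite hermC expr0 mul1r. Qed.

Lemma ip_suml (I : Type) (r : seq I) (Q : pred I) (F : I -> H) v :
  ip (\sum_(i <- r | Q i) F i) v = \sum_(i <- r | Q i) ip (F i) v.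
Proof. by rewrite linear_sumlz. Qed.

Lemma ip_sumr (I : Type) (r : seq I) (Q : pred I) (F : I -> H) v :
  ip v (\sum_(i <- r | Q i) F i) = \sum_(i <- r | Q i) ip v (F i).
Proof. by rewrite linear_sumr. Qed.

Lemma ipZl a u v : ip (a *: u) v = a * ip u v.
Proof. by rewrite linearZl_LR. Qed.

Lemma ipZr a u v : ip u (a *: v) = a * ip u v.
Proof. by rewrite linearZr_LR. Qed.

Lemma ipDl u v w : ip (u + v) w = ip u w + ip v w.
Proof. exact: linearDl. Qed.

Lemma ipDr u v w : ip u (v + w) = ip u v + ip u w.
Proof. exact: linearDr. Qed.

Lemma ipBl u v w : ip (u - v) w = ip u w - ip v w.
Proof. exact: linearBl. Qed.

Lemma ipBr u v w : ip u (v - w) = ip u v - ip u w.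
Proof. exact: linearBr. Qed.

Lemma ip0l v : ip 0 v = 0. Proof. exact: linear0l. Qed.

Lemma normD_sqr u v : `|u + v| ^+ 2 = `|u| ^+ 2 + 2 * ip u v + `|v| ^+ 2.
Proof. by rewrite -!ip_norm ipDl !ipDr (ipC v u); ring. Qed.

Lemma normB_sqr u v : `|u - v| ^+ 2 = `|u| ^+ 2 - 2 * ip u v + `|v| ^+ 2.
Proof. by rewrite -!ip_norm ipBl !ipBr (ipC v u); ring. Qed.

Lemma parallelogram (u v : H) :
  `|u + v| ^+ 2 + `|u - v| ^+ 2 = (`|u| ^+ 2 + `|v| ^+ 2) *+ 2.
Proof. by rewrite normD_sqr normB_sqr; ring. Qed.

(** The squared norm of [`|z| *: x - `|x| *: z] equals
[2 * (`|x| * `|z|) * (`|x| * `|z| - ip x z)] and is nonnegative. *)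
Lemma ip_cauchy_schwarz u v : `|ip u v| <= `|u| * `|v|.
Proof.
have le_ip (x z : H) : ip x z <= `|x| * `|z|.
  have [->|z0] := eqVneq z 0; first by rewrite ipC ip0l normr0 mulr0.
  have := sqr_ge0 (Num.norm (`|z| *: x - `|x| *: z)).
  rewrite normB_sqr !normrZ !normr_id ipZl ipZr.
  have zp : 0 < `|z| by rewrite normr_gt0.
  have [->|x0] := eqVneq x 0; first by rewrite ip0l normr0 mul0r.
  have xp : 0 < `|x| by rewrite normr_gt0.
  have xzp : 0 < `|x| * `|z| by exact: mulr_gt0.
  rewrite -(ler_pM2l xzp); nra.
rewrite ler_norml le_ip andbT lerNl.
by have := le_ip (- u) v; rewrite normrN linearNl.
Qed.

End InnerProduct.

(** * Orthogonal projection onto a closed subspace *)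

Section Completeness.
Context (R : realType) (H : completeNormedModType R).

(** The form of completeness in which both the projection and the Bochner
expectation are obtained: distances between terms are bounded by error terms
attached to each of them. *)
Lemma cauchy_rate_cvg (s : nat -> H) (r : nat -> R) : r @ \oo --> 0 ->
  (forall i j, `|s i - s j| <= r i + r j) -> exists l : H, s @ \oo --> l.
Proof.
move=> r0 sr; suff : cvg (s @ \oo) by move=> cs; exists (lim (s @ \oo)).
apply: cauchy_cvg; apply: cauchy_exP => e e0.
have /cvgrPdist_lt /(_ (e / 2)) := r0; rewrite divr_gt0// => /(_ isT) [N _ hN].
exists (s N); exists N => // j Nj; rewrite -ball_normE /= (le_lt_trans (sr _ _))//.
have := hN N (leqnn N); have := hN j Nj; rewrite /= !sub0r !normrN.
by move: (ler_norm (r N)) (ler_norm (r j)); lra.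
Qed.

End Completeness.

Section Projection.
Context (R : realType) (H : completeNormedModType R) (ip : {dot H for @idfun R}).
Hypothesis ip_norm : forall f, ip f f = `|f| ^+ 2.

(** A sequence of points of [M] minimizing the distance to [h] is Cauchy by the
parallelogram identity, because the midpoint of two of its terms is again in
[M]; its limit [w] is a nearest point, and then moving [w] inside [M] in the
direction [m] cannot help, to first order.  Closedness of [M] is sequential,
the form in which it is checked for sets of measurable functions. *)
Lemma orthogonal_projection (M : set H) : M 0 ->
  (forall a u v, M u -> M v -> M (a *: u + v)) ->
  (forall (s : nat -> H) l, (forall j, M (s j)) -> s @ \oo --> l -> M l) ->
  forall h, exists2 w, M w & forall m, M m -> ip (h - w) m = 0.
Proof.
move=> M0 Mlin Mlim h.
pose E : set R := [set `|h - m| ^+ 2 | m in M].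
have E0 : E !=set0 by exists (`|h - 0| ^+ 2), 0.
have Elb : lbound E 0 by move=> _ [m _ <-]; exact: exprn_ge0.
have Einf : has_inf E by split => //; exists 0.
pose D := inf E.
have DE m : M m -> D <= `|h - m| ^+ 2.
  by move=> Mm; apply: ge_inf; [exists 0|exists m].
(* The error is squared so that its root is a rate for the distances. *)
have near_opt j : exists m, M m /\ `|h - m| ^+ 2 < D + (harmonic j) ^+ 2 / 2.
  have e0 : 0 < (harmonic j : R) ^+ 2 / 2 by rewrite divr_gt0// exprn_gt0// invr_gt0.
  by have [_ [m Mm <-] mD] := inf_adherent e0 Einf; exists m.
have [s sP] := choice near_opt.
have harm0 j : 0 <= harmonic j :> R by rewrite invr_ge0.
have [i j|w sw] := cauchy_rate_cvg (s := s) cvg_harmonic.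
  rewrite -(ler_pXn2r (n := 2)) ?nnegrE ?addr_ge0//.
  have [Mi di] := sP i; have [Mj dj] := sP j.
  have mid : M (2^-1 *: s i + 2^-1 *: s j).
    by apply: (Mlin) => //; rewrite -[_ *: _]addr0; exact: Mlin.
  have := DE _ mid.
  have := parallelogram ip_norm (h - s j) (h - s i).
  have -> : h - s j - (h - s i) = s i - s j by rewrite opprB addrC addrA subrK.
  have -> : h - s j + (h - s i) = 2 *: (h - (2^-1 *: s i + 2^-1 *: s j)).
    rewrite scalerBr scalerDr !scalerA divff// !scale1r scaler_nat mulr2n.
    by rewrite addrACA -opprD [s j + _]addrC.
  rewrite normrZ exprMn ger0_norm//.
  have := mulr_ge0 (harm0 i) (harm0 j); move: di dj.
  set x := `|h - s i| ^+ 2; set z := `|h - s j| ^+ 2.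
  move: (harmonic i : R) (harmonic j : R) => a b; nra.
have Mw : M w by apply: (Mlim s) => // j; have [] := sP j.
exists w => // m Mm.
have wD : `|h - w| ^+ 2 <= D.
  have lim1 : (fun j => `|h - s j| ^+ 2) @ \oo --> `|h - w| ^+ 2.
    apply: (@cvg_comp _ _ _ (fun j => `|h - s j|) (fun x => x ^+ 2) _ (nbhs `|h - w|)).
      by apply: cvg_norm; apply: cvgB => //; exact: cvg_cst.
    exact: exprn_continuous.
  have lim2 : (fun j => D + (harmonic j : R) ^+ 2 / 2) @ \oo --> D + 0 ^+ 2 / 2.
    apply: cvgD; first exact: cvg_cst.
    apply: cvgMr_tmp.
    apply: (@cvg_comp _ _ _ harmonic (fun x => x ^+ 2) _ (nbhs (0 : R))).
      exact: cvg_harmonic.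
    exact: exprn_continuous.
  rewrite expr0n/= mul0r addr0 in lim2.
  apply: (ler_cvg_to lim1 lim2); apply: nearW => j.
  by have [_ /ltW] := sP j.
have opt a : 2 * a * ip (h - w) m <= a ^+ 2 * `|m| ^+ 2.
  have Mwm : M (a *: m + w) by exact: Mlin.
  have := le_trans wD (DE _ Mwm).
  have -> : h - (a *: m + w) = (h - w) - a *: m by rewrite opprD addrCA addrC.
  rewrite (normB_sqr ip_norm _ (a *: m)) ipZr normrZ exprMn real_normK ?num_real//; lra.
have [->|m0] := eqVneq m 0; first by rewrite ipC ip0l.
have mp : 0 < `|m| ^+ 2 by rewrite exprn_gt0// normr_gt0.
(* This coefficient makes [w + a *: m] the best point on the line through [w]. *)
have := opt (ip (h - w) m / `|m| ^+ 2).
move: (ip (h - w) m) (`|m| ^+ 2) mp => x y y0.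
have -> : 2 * (x / y) * x = 2 * (x ^+ 2 / y) by ring.
have -> : (x / y) ^+ 2 * y = x ^+ 2 / y by field; rewrite gt_eqF.
have : 0 <= x ^+ 2 / y by rewrite divr_ge0 ?sqr_ge0// ltW.
move=> h1 h2; have /eqP : x ^+ 2 / y = 0 by lra.
by rewrite mulf_eq0 invr_eq0 (gt_eqF y0) orbF sqrf_eq0 => /eqP.
Qed.

End Projection.

(** * Segmentations and partial sums *)

Lemma bigminn_geq (I : eqType) (r : seq I) (F : I -> nat) n0 j :
  j \in r -> (\big[minn/n0]_(i <- r) F i <= F j)%N.
Proof.
elim: r => // a r ih; rewrite inE big_cons => /predU1P[->|/ih]; first exact: geq_minl.
by move=> h; rewrite (leq_trans (geq_minr _ _)).
Qed.

Section SegmentationFacts.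
Context (n : nat) (t : segmentation n).

Lemma nseg_gt0 : (0 < nseg t)%N.
Proof. by have /and4P[] := breakpointsP t; rewrite /nseg; lia. Qed.

Lemma breakpoint0 : breakpoint t 0 = 0%N.
Proof. by have /and4P[_ /eqP] := breakpointsP t. Qed.

Lemma breakpoint_last : breakpoint t (nseg t) = n.
Proof.
by have /and4P[_ _ /eqP tn _] := breakpointsP t; rewrite /breakpoint nth_last.
Qed.

Lemma breakpoint_lt i j :
  (i < j)%N -> (j <= nseg t)%N -> (breakpoint t i < breakpoint t j)%N.
Proof.
move=> ij jn; have /and4P[t1 _ _ st] := breakpointsP t.
move: jn; rewrite /nseg => jn.
by apply: (sorted_ltn_nth ltn_trans 0%N st) => //; rewrite inE; lia.
Qed.

Lemma breakpoint_le_n l : (l <= nseg t)%N -> (breakpoint t l <= n)%N.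
Proof.
rewrite leq_eqVlt => /predU1P[->|ln]; first by rewrite breakpoint_last.
by rewrite -[leqRHS]breakpoint_last ltnW// breakpoint_lt.
Qed.

Lemma seg_length_gt0 l : (l < nseg t)%N -> (0 < seg_length t l)%N.
Proof. by move=> ln; rewrite /seg_length subn_gt0 breakpoint_lt. Qed.

Lemma segment_cover s :
  (s < n)%N -> exists2 l, (l < nseg t)%N &
    (breakpoint t l <= s < breakpoint t l.+1)%N.
Proof.
move=> sn; have ex : exists l, (s < breakpoint t l)%N.
  by exists (nseg t); rewrite breakpoint_last.
case: (ex_minnP ex) => -[|l]; first by rewrite breakpoint0.
move=> sl lmin; exists l.
  by have := lmin (nseg t); rewrite breakpoint_last => /(_ sn).
rewrite sl andbT leqNgt; apply/negP => /lmin; lia.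
Qed.

Definition prefix_sum (V : zmodType) (F : 'I_n -> V) (m : nat) : V :=
  \sum_(i < n | (i < m)%N) F i.

Lemma prefix_sumS (V : zmodType) (F : 'I_n -> V) (j : 'I_n) :
  prefix_sum F j.+1 = prefix_sum F j + F j.
Proof.
rewrite /prefix_sum (bigD1 j)//= addrC; congr (_ + _); apply: eq_bigl => i.
by rewrite ltnS [RHS]ltn_neqAle andbC.
Qed.

Lemma prefix_sum0 (V : zmodType) (F : 'I_n -> V) : prefix_sum F 0 = 0.
Proof. by rewrite /prefix_sum big_pred0. Qed.

Lemma prefix_sum_all (V : zmodType) (F : 'I_n -> V) : prefix_sum F n = \sum_i F i.
Proof. by apply: eq_bigl => i; rewrite ltn_ord. Qed.

Lemma interval_sum (V : zmodType) (F : 'I_n -> V) a b : (a <= b)%N ->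
  \sum_(i < n | (a <= i < b)%N) F i = prefix_sum F b - prefix_sum F a.
Proof.
move=> ab; rewrite /prefix_sum (bigID (fun i : 'I_n => (i < a)%N) (fun i => (i < b)%N))/=.
rewrite [X in X + _ - _](eq_bigl (fun i : 'I_n => (i < a)%N)); last by move=> i; lia.
by rewrite addrAC subrr add0r; apply: eq_bigl => i; lia.
Qed.

Lemma segment_sum (V : zmodType) (F : 'I_n -> V) l : (l < nseg t)%N ->
  \sum_(i in segment t l) F i =
  prefix_sum F (breakpoint t l.+1) - prefix_sum F (breakpoint t l).
Proof.
move=> ln; rewrite -interval_sum; last by rewrite ltnW// breakpoint_lt.
by apply: eq_bigl => i; rewrite inE.
Qed.

(** In terms of partial sums the sum over the segments telescopes. *)
Lemma sum_segments (V : zmodType) (F : 'I_n -> V) :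
  \sum_(l < nseg t) \sum_(i in segment t l) F i = \sum_i F i.
Proof.
under eq_bigr do rewrite segment_sum//.
rewrite -(big_mkord xpredT (fun l =>
  prefix_sum F (breakpoint t l.+1) - prefix_sum F (breakpoint t l))).
rewrite telescope_sumr// breakpoint_last breakpoint0 /prefix_sum.
rewrite [X in _ - X]big_pred0 ?subr0; last by move=> i; lia.
by apply: eq_bigl => i; rewrite ltn_ord.
Qed.

Lemma interval_cst (V : zmodType) (v : V) a b : (a <= b)%N -> (b <= n)%N ->
  \sum_(i < n | (a <= i < b)%N) v = v *+ (b - a).
Proof.
move=> ab bn; rewrite interval_sum// /prefix_sum.
by rewrite -!big_ord_widen ?(leq_trans ab)// !sumr_const !card_ord mulrnBr.
Qed.

Lemma segment_cst (V : zmodType) (v : V) l : (l < nseg t)%N ->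
  \sum_(i in segment t l) v = v *+ seg_length t l.
Proof.
move=> ln; rewrite -interval_cst ?breakpoint_le_n//; last first.
  by rewrite ltnW// breakpoint_lt.
by apply: eq_bigl => i; rewrite inE.
Qed.

Lemma seg_length_ge_min l : (l < nseg t)%N ->
  (\big[minn/n]_(l < nseg t) seg_length t l <= seg_length t l)%N.
Proof.
move=> ln; exact: (bigminn_geq (fun l : 'I_(nseg t) => seg_length t l) n
  (mem_index_enum (Ordinal ln))).
Qed.

Lemma Lambda_min_le (R : realType) l : (0 < n)%N -> (l < nseg t)%N ->
  Lambda_min R t * n%:R <= (seg_length t l)%:R.
Proof.
move=> n0 ln; rewrite /Lambda_min divfK ?pnatr_eq0 -?lt0n//.
by rewrite ler_nat seg_length_ge_min.
Qed.

End SegmentationFacts.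

(** * Least squares over a segmentation *)

Section LeastSquares.
Context (R : realType) (H : normedModType R) (ip : {dot H for @idfun R}).
Hypothesis ip_norm : forall f, ip f f = `|f| ^+ 2.
Context (n : nat).
Implicit Types (t : segmentation n) (u v e : 'I_n -> H).

Definition seg_mean t u l : H :=
  (seg_length t l)%:R^-1 *: \sum_(i in segment t l) u i.

(** The bilinear form of the orthogonal projection onto the families that are
constant on each segment.  Its diagonal is the part of the empirical risk that
depends on the segmentation. *)
Definition mean_pairing t u v : R :=
  \sum_(l < nseg t) ip (seg_mean t u l) (\sum_(i in segment t l) v i).

Lemma seg_sumE t u l : (l < nseg t)%N ->
  \sum_(i in segment t l) u i = (seg_length t l)%:R *: seg_mean t u l.
Proof.
move=> ln; rewrite /seg_mean scalerA divff ?scale1r// pnatr_eq0 -lt0n.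
exact: seg_length_gt0.
Qed.

Lemma empirical_riskE (U : Type) (k : U -> U -> R) (Phi : U -> H) (x : 'I_n -> U) t :
  (forall a b, k a b = ip (Phi a) (Phi b)) ->
  empirical_risk k x t = n%:R^-1 * (\sum_(i < n) k (x i) (x i)) -
    n%:R^-1 * mean_pairing t (fun i => Phi (x i)) (fun i => Phi (x i)).
Proof.
move=> kE; rewrite /empirical_risk; congr (_ - _ * _); apply: eq_bigr => l _.
rewrite /seg_mean ipZl ip_suml; congr (_ * _); apply: eq_bigr => i _.
by rewrite ip_sumr; apply: eq_bigr => j _; rewrite kE.
Qed.

Lemma mean_pairingC t u v : mean_pairing t u v = mean_pairing t v u.
Proof.
by apply: eq_bigr => l _; rewrite /seg_mean !ipZl ipC.
Qed.

Lemma mean_pairingDl t u v e :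
  mean_pairing t (fun i => u i + v i) e = mean_pairing t u e + mean_pairing t v e.
Proof.
rewrite -big_split/=; apply: eq_bigr => l _.
by rewrite /seg_mean big_split/= scalerDr ipDl.
Qed.

Lemma mean_pairing_sqrD t u v :
  mean_pairing t (fun i => u i + v i) (fun i => u i + v i) =
  mean_pairing t u u + 2 * mean_pairing t u v + mean_pairing t v v.
Proof.
rewrite mean_pairingDl !(mean_pairingC t _ (fun i => u i + v i)) !mean_pairingDl.
by rewrite (mean_pairingC t v u); ring.
Qed.

Lemma mean_pairing_ge0 t u : 0 <= mean_pairing t u u.
Proof.
apply: sumr_ge0 => l _; rewrite seg_sumE// ipZr ip_norm.
by rewrite mulr_ge0// exprn_ge0.
Qed.

(** A family that is constant on the segments is its own projection. *)
Lemma mean_pairing_cst t u v :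
  (forall (l : nat) (i j : 'I_n), (l < nseg t)%N ->
     i \in segment t l -> j \in segment t l -> u i = u j) ->
  mean_pairing t u v = \sum_i ip (u i) (v i).
Proof.
move=> ucst; rewrite -(sum_segments t); apply: eq_bigr => l _.
rewrite ip_sumr; apply: eq_bigr => i il; congr (ip _ _).
rewrite /seg_mean (eq_bigr (fun=> u i)); last by move=> j jl; exact: (ucst l).
rewrite segment_cst// -(scaler_nat _ (u i)) scalerA mulVf ?scale1r// pnatr_eq0 -lt0n.
exact: seg_length_gt0.
Qed.

Lemma residualE t u :
  \sum_(l < nseg t) \sum_(i in segment t l) `|u i - seg_mean t u l| ^+ 2 =
  \sum_i `|u i| ^+ 2 - mean_pairing t u u.
Proof.
rewrite -(sum_segments t) -sumrB; apply: eq_bigr => l _.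
under eq_bigr do rewrite (normB_sqr ip_norm).
rewrite big_split/= sumrB -mulr_sumr -ip_suml segment_cst//.
rewrite seg_sumE//; move: (seg_mean t u l) => m.
by rewrite ipZl ipZr ip_norm -mulr_natl; ring.
Qed.

Lemma seg_mean_dist t u c K l : (l < nseg t)%N ->
  (forall i, `|u i - c| <= K) -> `|seg_mean t u l - c| <= K.
Proof.
move=> ln uK; have l0 := seg_length_gt0 ln.
have l0' : 0 < (seg_length t l)%:R :> R by rewrite ltr0n.
have -> : seg_mean t u l - c =
    (seg_length t l)%:R^-1 *: \sum_(i in segment t l) (u i - c).
  rewrite sumrB segment_cst// scalerBr -(scaler_nat _ c) scalerA mulVf ?scale1r//.
  by rewrite gt_eqF.
rewrite normrZ ger0_norm ?invr_ge0// ler_pdivrMl//.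
apply: le_trans (ler_norm_sum _ _ _) _.
apply: (@le_trans _ _ (\sum_(i in segment t l) K)); first exact: ler_sum.
by rewrite segment_cst// mulr_natl.
Qed.

Section Noise.
Context (e : 'I_n -> H) (M : R).
Hypothesis prefix_le : forall m, (m <= n)%N -> `|prefix_sum e m| <= M.

Lemma segment_noise_le t l : (l < nseg t)%N ->
  `|\sum_(i in segment t l) e i| <= 2 * M.
Proof.
move=> ln; rewrite segment_sum//.
apply: le_trans (ler_normB _ _) _.
rewrite mulr_natl mulr2n lerD// prefix_le// breakpoint_le_n//.
exact: ltnW.
Qed.

(** Only the deviations of the segment means of [u] from [c] are charged to the
noise.  What they leave out, the pairing of [c] with the total noise, does not
depend on [t] and cancels when two segmentations are compared. *)
Lemma mean_pairing_noise_le t u c K : 0 <= K ->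
  (forall i, `|u i - c| <= K) ->
  `|mean_pairing t u e - ip c (\sum_i e i)| <= (nseg t)%:R * (K * (2 * M)).
Proof.
move=> K0 uK; rewrite -(sum_segments t) ip_sumr -sumrB.
apply: le_trans (ler_norm_sum _ _ _) _.
apply: (@le_trans _ _ (\sum_(l < nseg t) (K * (2 * M)))); last first.
  by rewrite sumr_const card_ord [leRHS]mulr_natl.
apply: ler_sum => l _; rewrite -ipBl.
apply: le_trans (ip_cauchy_schwarz ip_norm _ _) _.
by rewrite ler_pM// ?segment_noise_le// seg_mean_dist.
Qed.

Lemma mean_pairing_noise_sqr_le t (L : R) : 0 < L ->
  (forall l, (l < nseg t)%N -> L <= (seg_length t l)%:R) ->
  mean_pairing t e e <= (nseg t)%:R * ((2 * M) ^+ 2 / L).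
Proof.
move=> L0 hL.
apply: (@le_trans _ _ (\sum_(l < nseg t) ((2 * M) ^+ 2 / L))); last first.
  by rewrite sumr_const card_ord [leRHS]mulr_natl.
apply: ler_sum => l _; rewrite /seg_mean ipZl ip_norm mulrC.
rewrite ler_pM ?exprn_ge0// ?invr_ge0//.
  rewrite lerXn2r ?nnegrE ?segment_noise_le//.
  by rewrite (le_trans _ (segment_noise_le (ltn_ord l))).
by rewrite lef_pV2 ?posrE ?hL// (lt_le_trans L0) ?hL.
Qed.

End Noise.

(** The energy of [u + e] for the true segmentation is at least the full energy of
[u] plus a cross term, since [u] is its own projection there and the energy of
[e] is nonnegative.  Expanding the energy for [t] gives the residual of [u]. *)
Lemma residual_le t tstar u e :
  (forall (l : nat) (i j : 'I_n), (l < nseg tstar)%N ->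
     i \in segment tstar l -> j \in segment tstar l -> u i = u j) ->
  mean_pairing tstar (fun i => u i + e i) (fun i => u i + e i) <=
  mean_pairing t (fun i => u i + e i) (fun i => u i + e i) ->
  \sum_(l < nseg t) \sum_(i in segment t l) `|u i - seg_mean t u l| ^+ 2 <=
  2 * (mean_pairing t u e - mean_pairing tstar u e) + mean_pairing t e e.
Proof.
move=> ucst; rewrite !mean_pairing_sqrD residualE.
rewrite (mean_pairing_cst u ucst).
under [X in X + _ + _ <= _ -> _]eq_bigr do rewrite ip_norm.
have := mean_pairing_ge0 tstar e; lra.
Qed.

Lemma sqrB_half (a b c : H) : `|a - b| ^+ 2 / 2 <= `|a - c| ^+ 2 + `|b - c| ^+ 2.
Proof.
have := sqr_ge0 `|(a - c) + (b - c)|.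
have := parallelogram ip_norm (a - c) (b - c).
have -> : a - c - (b - c) = a - b by rewrite opprB addrA subrK.
lra.
Qed.

(** The window of radius [m] around [s] contains no breakpoint of [t] in its
interior, so that all its points are fitted by the same vector, while [u] takes
the value [a] on its left half and [b] on its right half.  The extreme
breakpoints 0 and [n] are outside by the two bounds on [m]. *)
Lemma residual_ge t u (a b : H) s m :
  (m <= s)%N -> (s + m <= n)%N -> (0 < s)%N -> (s < n)%N ->
  (forall i : 'I_n, (s - m <= i < s)%N -> u i = a) ->
  (forall i : 'I_n, (s <= i < s + m)%N -> u i = b) ->
  (forall j, (0 < j < nseg t)%N -> (m <= `|s - breakpoint t j|)%N) ->
  m%:R * (`|a - b| ^+ 2 / 2) <=
  \sum_(l < nseg t) \sum_(i in segment t l) `|u i - seg_mean t u l| ^+ 2.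
Proof.
move=> ms smn s0 sn ua ub far.
have [l ln /andP[bs sb]] := segment_cover t sn.
have lo : (breakpoint t l <= s - m)%N.
  case: l ln bs {sb} => [|l] ln bs; first by rewrite breakpoint0.
  by have := far l.+1 ln; lia.
have hi : (s + m <= breakpoint t l.+1)%N.
  move: ln; rewrite leq_eqVlt => /predU1P[->|ln]; first by rewrite breakpoint_last.
  by have := far l.+1 ln; lia.
rewrite (bigD1 (Ordinal ln))//=; set c := seg_mean t u l.
apply: (@le_trans _ _ (\sum_(i in segment t l) `|u i - c| ^+ 2)); last first.
  rewrite lerDl; apply: sumr_ge0 => j _; apply: sumr_ge0 => i _; exact: exprn_ge0.
rewrite (bigID (fun i : 'I_n => (s - m <= i < s + m)%N))/=.
rewrite -[leLHS]addr0 lerD//; last by apply: sumr_ge0 => i _; exact: exprn_ge0.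
rewrite (bigID (fun i : 'I_n => (i < s)%N))/=.
rewrite [X in _ <= X + _](eq_bigl (fun i : 'I_n => (s - m <= i < s)%N)); last first.
  by move=> i; rewrite inE; lia.
rewrite [X in _ <= _ + X](eq_bigl (fun i : 'I_n => (s <= i < s + m)%N)); last first.
  by move=> i; rewrite inE; lia.
rewrite [X in _ <= X + _](eq_bigr (fun=> `|a - c| ^+ 2)); last by move=> i /ua ->.
rewrite [X in _ <= _ + X](eq_bigr (fun=> `|b - c| ^+ 2)); last by move=> i /ub ->.
rewrite !interval_cst ?leq_addr ?leq_subr// 1?ltnW//.
rewrite subKn// addnC addnK -mulrnDl -[leRHS]mulr_natl ler_wpM2l//.
exact: sqrB_half.
Qed.

End LeastSquares.

(** * Localization of the change points given small noise *)

Section JumpFacts.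
Context (R : realType) (n : nat) (H : normedModType R) (mu : 'I_n -> H).

Lemma le_Delta_max (i j : 'I_n) : j = i.+1 :> nat ->
  `|mu i - mu j| <= Delta_max mu.
Proof.
move=> ij; rewrite /Delta_max.
by apply: (@le_bigmax_cond _ _ _ _ (i, j) _ (fun p => `|mu p.1 - mu p.2|)); apply/eqP.
Qed.

Lemma Delta_max_ge0 : 0 <= Delta_max mu.
Proof. exact: bigmax_ge_id. Qed.

Lemma Delta_min_le (i j : 'I_n) : j = i.+1 :> nat -> mu i <> mu j ->
  Delta_min mu <= `|mu i - mu j|.
Proof.
move=> ij /eqP mij; rewrite /Delta_min.
apply: (@bigmin_le_cond _ _ _ _ (i, j) _ (fun p => `|mu p.1 - mu p.2|)) => /=.
by rewrite mij andbT; apply/eqP.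
Qed.

Lemma Delta_min_gt0 : 0 < Delta_max mu -> 0 < Delta_min mu.
Proof.
move=> D0; apply: lt_bigmin => // -[i j] /= /andP[_ mij].
by rewrite normr_gt0 subr_eq0.
Qed.

Context (t : segmentation n) (mut : is_true_segmentation mu t).

Lemma segment_jump l : (l.+1 < nseg t)%N -> exists i j : 'I_n,
  [/\ i = (breakpoint t l.+1).-1 :> nat, j = breakpoint t l.+1 :> nat,
      i \in segment t l & j \in segment t l.+1].
Proof.
move=> ln; have b01 : (breakpoint t l < breakpoint t l.+1)%N.
  by apply: breakpoint_lt => //; exact: ltnW.
have b12 : (breakpoint t l.+1 < breakpoint t l.+2)%N by exact: breakpoint_lt.
have b2n : (breakpoint t l.+2 <= n)%N by exact: breakpoint_le_n.
have jn : (breakpoint t l.+1 < n)%N by lia.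
have i_n : ((breakpoint t l.+1).-1 < n)%N by lia.
by exists (Ordinal i_n), (Ordinal jn); split => //; rewrite inE /=; lia.
Qed.

(** Going from the first value to any other one crosses at most one jump per
segment. *)
Lemma true_segmentation_diameter (i0 i : 'I_n) : i0 = 0%N :> nat ->
  `|mu i - mu i0| <= (nseg t)%:R * Delta_max mu.
Proof.
move=> i00; have [mucst _] := mut.
have main l (j : 'I_n) : (l < nseg t)%N -> j \in segment t l ->
    `|mu j - mu i0| <= l%:R * Delta_max mu.
  elim: l j => [|l ih] j ln jl.
    rewrite (mucst _ _ i0 ln jl) ?subrr ?normr0 ?mul0r//.
    by have := breakpoint_lt (ltnSn 0) ln; rewrite inE breakpoint0 i00.
  have [p [q [pE qE pl ql]]] := segment_jump ln.
  rewrite (mucst _ _ q ln jl ql) -(subrKA (mu p)) -natr1 mulrDl mul1r addrC.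
  rewrite (le_trans (ler_normD _ _))// lerD ?(ih p)// 1?ltnW//.
  rewrite distrC le_Delta_max// qE pE prednK//.
  by apply: leq_ltn_trans (breakpoint_lt (ltnSn l) (ltnW ln)).
have [l ln il] := segment_cover t (ltn_ord i).
apply: le_trans (main l i ln _) _; first by rewrite inE.
by rewrite ler_wpM2r ?Delta_max_ge0// ler_nat ltnW.
Qed.

Lemma true_segmentation_jump : (2 <= nseg t)%N -> 0 < Delta_max mu.
Proof.
move=> t2; have [_ mujump] := mut; have [p [q [pE qE pl ql]]] := segment_jump t2.
have /eqP pq := mujump _ _ _ t2 pl ql.
have := @le_Delta_max p q; rewrite qE pE prednK; last first.
  by apply: leq_ltn_trans (breakpoint_lt (ltnSn 0) (ltnW t2)).
by move=> /(_ erefl); apply: lt_le_trans; rewrite normr_gt0 subr_eq0.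
Qed.

End JumpFacts.

(** The two terms of [v2] are chosen for this: multiplied by [n] and by half the
squared smallest jump, they become the bounds on the linear noise term, with some
room, and on the quadratic one. *)
Lemma v2_noise_budget (R : realType) (n D : nat) (H : normedModType R) (mu : 'I_n -> H)
    (V y delta : R) : (0 < n)%N -> 0 < Delta_min mu -> 0 < V -> 0 < delta ->
  v2 mu D V y delta * n%:R * (Delta_min mu ^+ 2 / 2) =
  12 * D%:R ^+ 2 * Delta_max mu * (y * Num.sqrt (n%:R * V)) +
  D%:R * ((2 * (y * Num.sqrt (n%:R * V))) ^+ 2 / (delta * n%:R)).
Proof.
move=> n0 dm V0 d0; rewrite /v2 sqrtrM//.
have N0 : 0 < n%:R :> R by rewrite ltr0n.
have wE : Num.sqrt V ^+ 2 = V by rewrite sqr_sqrtr// ltW.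
have sE : Num.sqrt n%:R ^+ 2 = n%:R :> R by rewrite sqr_sqrtr// ltW.
have w0 : 0 < Num.sqrt V by rewrite sqrtr_gt0.
have s0 : 0 < Num.sqrt (n%:R : R) by rewrite sqrtr_gt0.
move: (Delta_max mu) (Delta_min mu) dm => A B B0.
move: (Num.sqrt V) (Num.sqrt n%:R) wE sE w0 s0 => w s <- <- w0 s0.
by field; rewrite !gt_eqF.
Qed.

Lemma jump_window (m b0 b1 b2 n : nat) :
  (m <= b1 - b0)%N -> (m <= b2 - b1)%N -> (b0 < b1 < b2)%N -> (b2 <= n)%N ->
  [/\ (0 < b1 < n)%N, (m <= b1)%N, (b1 + m <= n)%N,
      (b0 <= b1 - m)%N & (b1 + m <= b2)%N].
Proof. by move=> *; split; lia. Qed.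

(** The linear term costs at most 8 of the 12 units that the budget grants it. *)
Lemma noise_budget_exceeded (R : realType) (lhs P Ps c Q q D A M : R) :
  lhs <= 2 * (P - Ps) + Q -> Q <= q ->
  - (D * (D * A * (2 * M))) <= Ps - c -> P - c <= D * (D * A * (2 * M)) ->
  lhs = 12 * D ^+ 2 * A * M + q -> 0 < D ^+ 2 * (A * M) -> False.
Proof. move=> *; lra. Qed.

Section Localization.
Context (R : realType) (H : normedModType R) (ip : {dot H for @idfun R}).
Hypothesis ip_norm : forall f, ip f f = `|f| ^+ 2.

Lemma change_point_localization n (mu e : 'I_n -> H) (t tfit : segmentation n)
    (V y delta : R) :
  is_true_segmentation mu t -> (2 <= nseg t)%N -> nseg tfit = nseg t ->
  0 < V -> 0 < y -> 0 < delta ->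
  (forall m, (m <= n)%N -> `|prefix_sum e m| <= y * Num.sqrt (n%:R * V)) ->
  delta <= Lambda_min R tfit ->
  mean_pairing ip t (fun i => mu i + e i) (fun i => mu i + e i) <=
  mean_pairing ip tfit (fun i => mu i + e i) (fun i => mu i + e i) ->
  v2 mu (nseg t) V y delta <= Lambda_min R t ->
  (d_infty1 t tfit)%:R / n%:R <= v2 mu (nseg t) V y delta.
Proof.
move=> mut t2 tfitD V0 y0 d0 eM dtfit fit v2L.
have n0 : (0 < n)%N.
  have := breakpoint_lt (nseg_gt0 t) (leqnn _).
  by rewrite breakpoint0 breakpoint_last.
have N0 : 0 < n%:R :> R by rewrite ltr0n.
have Dm0 := true_segmentation_jump mut t2.
have dm0 := Delta_min_gt0 Dm0.
have v20 : 0 <= v2 mu (nseg t) V y delta.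
  rewrite /v2 addr_ge0// !mulr_ge0// ?invr_ge0 ?exprn_ge0 ?sqrtr_ge0 ?Delta_max_ge0//.
  all: try exact: ltW. all: try by apply: mulr_ge0 => //; exact: ltW.
rewrite /d_infty1 big_nat.
apply: (big_ind (fun x : nat => x%:R / n%:R <= v2 mu (nseg t) V y delta)).
- by rewrite mul0r.
- by move=> x z hx hz; case: (leqP x z).
move=> l /andP[l0 ln].
set dl := \big[minn/n]_(1 <= j < nseg tfit) _.
rewrite leNgt; apply/negP; rewrite ltr_pdivlMr// => far.
set ml := \big[minn/n]_(l < nseg t) seg_length t l.
(* The window must fit both in the adjacent true segments and between the
   estimated change points. *)
pose m := minn ml dl.
have mv2 : v2 mu (nseg t) V y delta * n%:R <= m%:R.
  rewrite /m; case: (leqP ml dl) => _; last exact: ltW.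
  by rewrite -ler_pdivlMr.
have [mucst mujump] := mut.
case: l l0 ln @dl far @m mv2 => // l _ ln dl far m mv2.
have [p [q [pE qE pl ql]]] := segment_jump ln.
have m1 : (m <= seg_length t l)%N.
  by rewrite (leq_trans (geq_minl _ _))// seg_length_ge_min// ltnW.
have m2 : (m <= seg_length t l.+1)%N.
  by rewrite (leq_trans (geq_minl _ _))// seg_length_ge_min.
have b01 : (breakpoint t l < breakpoint t l.+1)%N.
  by apply: breakpoint_lt => //; exact: ltnW.
have b12 : (breakpoint t l.+1 < breakpoint t l.+2)%N by exact: breakpoint_lt.
have b2n : (breakpoint t l.+2 <= n)%N by exact: breakpoint_le_n.
move: m1 m2; rewrite /seg_length => m1 m2.
have b012 : (breakpoint t l < breakpoint t l.+1 < breakpoint t l.+2)%N.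
  by rewrite b01.
have [/andP[s0 sn] ms smn lo hi] := jump_window m1 m2 b012 b2n.
have lower : m%:R * (`|mu p - mu q| ^+ 2 / 2) <=
  \sum_(l < nseg tfit) \sum_(i in segment tfit l) `|mu i - seg_mean tfit mu l| ^+ 2.
  apply: (residual_ge ip_norm ms smn s0 sn).
  - move=> i /andP[i1 i2]; apply: (mucst l) => //; first exact: ltnW.
    by rewrite inE i2 (leq_trans lo).
  - move=> i /andP[i1 i2]; apply: (mucst l.+1) => //.
    by rewrite inE i1 (leq_trans i2).
  - move=> j hj; rewrite (leq_trans (geq_minr _ _))//.
    by apply: bigminn_geq; rewrite mem_index_iota.
have upper := residual_le ip_norm mucst fit.
have i0P : 0%N = Ordinal n0 by [].
have diam i := true_segmentation_diameter mut i (esym i0P).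
have K0 : 0 <= (nseg t)%:R * Delta_max mu by rewrite mulr_ge0// Delta_max_ge0.
have := mean_pairing_noise_le ip_norm eM tfit K0 diam.
have := mean_pairing_noise_le ip_norm eM t K0 diam.
have L0 : 0 < delta * n%:R by exact: mulr_gt0.
have := mean_pairing_noise_sqr_le ip_norm eM (t := tfit) L0.
rewrite tfitD !ler_norml => /(_ _)/wrap[|noise].
  move=> j jn; rewrite -tfitD in jn; apply: le_trans (Lambda_min_le R n0 jn).
  by rewrite ler_wpM2r// ltW.
move=> /andP[s1 _] /andP[_ s2].
have pq : Delta_min mu <= `|mu p - mu q|.
  apply: Delta_min_le; last exact: mujump pl ql.
  by rewrite qE pE prednK.
have budget := v2_noise_budget (nseg t) y n0 dm0 V0 d0.
have step1 : v2 mu (nseg t) V y delta * n%:R * (Delta_min mu ^+ 2 / 2) <=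
    m%:R * (`|mu p - mu q| ^+ 2 / 2).
  apply: ler_pM => //; first by rewrite mulr_ge0// ltW.
    by rewrite divr_ge0// exprn_ge0// ltW.
  by rewrite ler_wpM2r ?invr_ge0// lerXn2r ?nnegrE ?normr_ge0 ?(ltW dm0).
have M0 : 0 < (nseg t)%:R ^+ 2 * (Delta_max mu * (y * Num.sqrt (n%:R * V))).
  rewrite !mulr_gt0// ?exprn_gt0// ?ltr0n ?sqrtr_gt0 ?mulr_gt0//; exact: ltnW.
exact: noise_budget_exceeded (le_trans step1 (le_trans lower upper)) noise s1 s2
  budget M0.
Qed.

End Localization.

(** * Integrals of simple functions and Bochner expectations *)

Section RealIntegral.
Context d (T : measurableType d) (R : realType) (P : probability T R).
Implicit Types (f g : T -> R).

Lemma integ_measurable f : integ P f -> measurable_fun setT f.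
Proof. by move=> /integrableP[/measurable_EFinP]. Qed.

Lemma integ_cst (c : R) : integ P (fun=> c).
Proof. exact: (finite_measure_integrable_cst P c measurableT). Qed.

Lemma integD f g : integ P f -> integ P g -> integ P (fun w => f w + g w).
Proof. by move=> fi gi; exact: (integrableD measurableT fi gi). Qed.

Lemma integZ (c : R) f : integ P f -> integ P (fun w => c * f w).
Proof. by move=> fi; exact: (integrableZl measurableT c fi). Qed.

Lemma integN f : integ P f -> integ P (fun w => - f w).
Proof. by move=> /(integZ (-1)); under [in X in X -> _]eq_fun do rewrite mulN1r. Qed.

Lemma integB f g : integ P f -> integ P g -> integ P (fun w => f w - g w).
Proof. by move=> fi /integN; exact: integD. Qed.

Lemma integ_le f g : measurable_fun setT f -> (forall w, `|f w| <= g w) ->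
  integ P g -> integ P f.
Proof.
move=> mf fg; apply: le_integrable => //; first exact/measurable_EFinP.
by move=> w _ /=; rewrite lee_fin (le_trans (fg w))// ler_norm.
Qed.

Lemma integ_sum (I : Type) (r : seq I) (Q : pred I) (F : I -> T -> R) :
  (forall i, Q i -> integ P (F i)) -> integ P (fun w => \sum_(i <- r | Q i) F i w).
Proof.
move=> Fi; rewrite (_ : _ \o _ = fun w => \sum_(i <- r | Q i) (F i w)%:E)%E; last first.
  by apply/funext => w /=; rewrite sumEFin.
exact: (integrable_sum measurableT r Fi).
Qed.

Lemma Rintegral_sum (I : Type) (r : seq I) (F : I -> T -> R) :
  (forall i, integ P (F i)) ->
  \int[P]_w (\sum_(i <- r) F i w) = \sum_(i <- r) \int[P]_w F i w.
Proof.
move=> Fi; elim: r => [|i r ih].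
  under eq_Rintegral do rewrite big_nil.
  by rewrite big_nil Rintegral_cst// mul0r.
under eq_Rintegral do rewrite big_cons.
by rewrite RintegralD// ?ih ?big_cons//; exact: integ_sum.
Qed.

Lemma integ_indicM (A : set T) f : measurable A -> integ P f ->
  integ P (fun w => \1_A w * f w).
Proof.
move=> mA fi; apply: (integ_le (g := fun w => `|f w|)).
- apply: measurable_funM; first exact: measurable_indic.
  exact: integ_measurable.
- move=> w; rewrite normrM indicE; case: (w \in A); rewrite ?normr1 ?mul1r//.
  by rewrite normr0 mul0r.
- exact: integrable_norm.
Qed.

Lemma Rintegral_indicM (A : set T) (c : R) : measurable A ->
  \int[P]_w (\1_A w * c) = fine (P A) * c.
Proof.
move=> mA; rewrite RintegralZr//; last first.
  have := integ_indicM mA (integ_cst 1).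
  by under [in X in X -> _]eq_fun do rewrite mulr1.
by rewrite /Rintegral integral_indic// setIT.
Qed.

End RealIntegral.

Section SimpleFunctions.
Context d (T : measurableType d) (R : realType) (P : probability T R).
Context (H : completeNormedModType R) (ip : {dot H for @idfun R}).

Lemma simple_comp_sum (s : T -> H) (G : H -> T -> R) w : finite_set (range s) ->
  G (s w) w =
  \sum_(h <- finmap.enum_fset (fset_set (range s))) \1_(s @^-1` [set h]) w * G h w.
Proof.
move=> fs; rewrite (bigD1_seq (s w)) ?finmap.fset_uniq//=; last first.
  by rewrite in_fset_set// inE; exists w.
rewrite indicE mem_set// mul1r big1 ?addr0// => h /eqP hs.
by rewrite indicE memNset ?mul0r// => /= sh; exact: hs.
Qed.

Lemma simple_integ (s : T -> H) (G : H -> T -> R) : simple_function s ->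
  (forall h, integ P (G h)) -> integ P (fun w => G (s w) w).
Proof.
move=> [fs ms] Gi; under [X in _ \o X]eq_fun do rewrite (simple_comp_sum G _ fs).
by apply: integ_sum => h _; exact: integ_indicM.
Qed.

Lemma simple_expectation_ip (s : T -> H) f : simple_function s ->
  ip (simple_expectation P s) f = \int[P]_w ip (s w) f.
Proof.
move=> [fs ms]; rewrite /simple_expectation fsbig_finite//= ip_suml.
under eq_Rintegral do rewrite (simple_comp_sum (fun h _ => ip h f) _ fs).
rewrite Rintegral_sum; last by move=> h; apply: integ_indicM => //; exact: integ_cst.
by apply: eq_bigr => h _; rewrite ipZl Rintegral_indicM.
Qed.

End SimpleFunctions.

Section BochnerExpectation.
Context d (T : measurableType d) (R : realType) (P : probability T R).
Context (H : completeNormedModType R) (ip : {dot H for @idfun R}).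
Hypothesis ip_norm : forall f, ip f f = `|f| ^+ 2.
Context (Y : T -> H).
Hypothesis mYdist : forall h, measurable_fun setT (fun w => `|Y w - h|).
Hypothesis mYip : forall h, measurable_fun setT (fun w => ip (Y w) h).
Hypothesis Yi : integ P (fun w => `|Y w|).

Lemma integ_dist h : integ P (fun w => `|Y w - h|).
Proof.
apply: (integ_le (g := fun w => `|Y w| + `|h|)) => //.
- by move=> w; rewrite normr_id ler_normB.
- by apply: integD => //; exact: integ_cst.
Qed.

Lemma integ_ip h : integ P (fun w => ip (Y w) h).
Proof.
apply: (integ_le (g := fun w => `|h| * `|Y w|)) => //.
- by move=> w; rewrite mulrC ip_cauchy_schwarz.
- exact: integZ.
Qed.

(** Testing against vectors reduces the expectation of a vector-valued simple
function to scalar integrals. *)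
Lemma simple_expectation_dist (s : T -> H) f : simple_function s ->
  `|ip (simple_expectation P s) f - \int[P]_w ip (Y w) f| <=
  `|f| * \int[P]_w `|Y w - s w|.
Proof.
move=> ss; rewrite (simple_expectation_ip P ip f ss).
have is1 : integ P (fun w => ip (s w) f).
  by apply: (simple_integ (G := fun h _ => ip h f) ss) => h; exact: integ_cst.
have is2 : integ P (fun w => `|Y w - s w|).
  by apply: (simple_integ (G := fun h w => `|Y w - h|) ss) => h; exact: integ_dist.
have is3 := integ_ip f.
rewrite -RintegralB// -RintegralZl//.
apply: le_trans (le_normr_Rintegral _ _) _ => //; first exact: integB.
apply: le_Rintegral => //; [|exact: integZ|].
  by apply: integrable_norm; exact: integB.
move=> w _; rewrite -ipBl mulrC distrC.
by rewrite (le_trans (ip_cauchy_schwarz ip_norm _ _))// distrC.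
Qed.

(** The strong approximation passes to every inner product, so that a Bochner
expectation is a weak one as well. *)
Lemma bochner_expectation_ip m f : is_bochner_expectation P Y m ->
  ip m f = \int[P]_w ip (Y w) f.
Proof.
move=> [s [ss _ Is Es]].
have Ifin : (fun j => \int[P]_w `|Y w - s j w|) @ \oo --> 0.
  by apply: (fine_cvg (a := 0)).
apply/eqP; rewrite -subr_eq0 -normr_le0.
have bound : (fun j => (`|m - simple_expectation P (s j)| +
   \int[P]_w `|Y w - s j w|) * `|f|) @ \oo --> (0 + 0) * `|f|.
  apply: cvgMr_tmp; apply: cvgD => //.
  by rewrite -(normr0 H) -(subrr m); apply: cvg_norm; apply: cvgB => //; exact: cvg_cst.
rewrite addr0 mul0r in bound.
apply: (ler_cvg_to (cvg_cst _) bound); apply: nearW => j.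
rewrite -(subrKA (ip (simple_expectation P (s j)) f)) mulrDl.
rewrite (le_trans (ler_normD _ _))// lerD//.
  by rewrite -ipBl ip_cauchy_schwarz.
by rewrite mulrC simple_expectation_dist.
Qed.

Section Existence.
Context (h_ : nat -> H).
Hypothesis h_dense : forall x e, 0 < e -> exists j, `|x - h_ j| < e.

(** The point nearest to [Y w] among the origin and the first [m] points of a
dense sequence.  Including the origin bounds the error by [`|Y w|], which makes
dominated convergence applicable. *)
Fixpoint nearest (m : nat) (w : T) : H :=
  if m is m'.+1 then
    if `|Y w - h_ m'| < `|Y w - nearest m' w| then h_ m' else nearest m' w
  else 0.

Lemma nearestS_dist m w : `|Y w - nearest m.+1 w| =
  Num.min `|Y w - h_ m| `|Y w - nearest m w|.
Proof. by rewrite /= /Num.min; case: ifP. Qed.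

Lemma measurable_nearest_dist m : measurable_fun setT (fun w => `|Y w - nearest m w|).
Proof.
elim: m => [|m ih]; first exact: mYdist.
under eq_fun do rewrite nearestS_dist.
exact: measurable_minr.
Qed.

Lemma nearest_simple m : simple_function (nearest m).
Proof.
elim: m => [|m [fm mm]]; split.
- by apply: (@sub_finite_set _ _ [set 0]) => // _ [w _ <-].
- move=> h; rewrite (_ : _ @^-1` _ = cst (0 : H) @^-1` [set h])//.
  by rewrite preimage_cst; case: ifP.
- apply: (@sub_finite_set _ _ (range (nearest m) `|` [set h_ m])).
    by move=> _ [w _ <-] /=; case: ifP => _; [right|left; exists w].
  by rewrite finite_setU.
- move=> h; set C := [set w | `|Y w - h_ m| < `|Y w - nearest m w|].
  have mC : measurable C.
    have := measurable_fun_ltr (mYdist (h_ m)) (measurable_nearest_dist m).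
    by move=> /(_ measurableT [set true]); rewrite setTI; exact.
  have -> : nearest m.+1 @^-1` [set h] =
      (C `&` [set _ | h_ m = h]) `|` (~` C `&` nearest m @^-1` [set h]).
    apply/seteqP; split => w /=; rewrite /C /=.
      by case: ifP => cw; [left|right].
    by case: ifP => cw [] [].
  apply: measurableU; apply: measurableI => //; last exact: measurableC.
  by have [hh|hh] := pselect (h_ m = h); [rewrite (_ : mkset _ = setT)//|
    rewrite (_ : mkset _ = set0)//]; apply/seteqP; split.
Qed.

Lemma nearest_dist_le m w : `|Y w - nearest m w| <= `|Y w|.
Proof.
elim: m => [|m ih]; first by rewrite subr0.
by rewrite nearestS_dist (le_trans _ ih)// ge_min lexx orbT.
Qed.

Lemma nearest_cvg w : (fun m => `|Y w - nearest m w|) @ \oo --> 0.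
Proof.
apply/cvgrPdist_lt => e e0; have [j hj] := h_dense (Y w) e0.
exists j.+1 => // m /= jm; rewrite sub0r normrN normr_id.
apply: le_lt_trans hj; elim: m jm => // m ih; rewrite ltnS leq_eqVlt nearestS_dist.
move=> /predU1P[<-|/ih jm]; first by rewrite ge_min lexx.
by rewrite ge_min jm orbT.
Qed.

Lemma nearest_mean_cvg :
  (\int[P]_w (`|Y w - nearest m w|)%:E)%E @[m --> \oo] --> 0%E.
Proof.
have [] := @dominated_convergence _ _ _ P setT measurableT
  (fun m w => (`|Y w - nearest m w|)%:E) (cst 0%E) (fun w => (`|Y w|)%:E).
- by move=> m; apply/measurable_EFinP; exact: measurable_nearest_dist.
- exact: measurable_cst.
- by apply: aeW => w _; apply: cvg_EFin; [exact: nearW|exact: nearest_cvg].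
- exact: Yi.
- by apply: aeW => w m _; rewrite lee_fin normr_id nearest_dist_le.
- by move=> _ _; rewrite integral0.
Qed.

(** Convergence of the expectations of the approximations follows from
completeness: testing their difference [f] against [f] itself bounds [`|f|] by
the sum of the two mean errors. *)
Lemma bochner_expectation_exists : exists m, is_bochner_expectation P Y m.
Proof.
have Ifin : (fun j => \int[P]_w `|Y w - nearest j w|) @ \oo --> 0.
  by apply: (fine_cvg (a := 0)); exact: nearest_mean_cvg.
have [i j|m Em] := cauchy_rate_cvg (s := fun j => simple_expectation P (nearest j)) Ifin.
  set f := _ - _; have [->|f0] := eqVneq f 0.
    by rewrite normr0 addr_ge0// Rintegral_ge0.
  have fp : 0 < `|f| by rewrite normr_gt0.
  rewrite -(ler_pM2l fp) -expr2 -ip_norm {1}/f ipBl.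
  rewrite (le_trans (ler_norm _))// -(subrKA (\int[P]_w ip (Y w) f)).
  rewrite (le_trans (ler_normD _ _))// mulrDr lerD//.
    exact/simple_expectation_dist/nearest_simple.
  by rewrite distrC; exact/simple_expectation_dist/nearest_simple.
exists m; exists nearest; split => //.
- exact: nearest_simple.
- apply: aeW => w; apply/cvgrPdist_lt => e e0.
  have /cvgrPdist_lt /(_ e e0) := nearest_cvg w.
  by apply: filterS => j; rewrite sub0r normrN normr_id.
- exact: nearest_mean_cvg.
Qed.

End Existence.

Lemma bochner_expectation_pairing : separable_space H ->
  forall f, ip (bochner_expectation P Y) f = \int[P]_w ip (Y w) f.
Proof.
move=> [S [cS dS]] f; apply: bochner_expectation_ip.
apply: xgetPex.
(* A countable dense set is nonempty, hence the range of a sequence. *)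
have [S0|[h_]] := pfcard_geP cS.
  have [x] := dS setT (ex_intro _ 0 I) openT.
  by rewrite S0 setTI.
apply: (@bochner_expectation_exists h_) => x e e0.
have [z [xz Sz]] := dS (ball x e) (ex_intro _ x (ballxx x e0)) (ball_open x e).
by have [j _ jz] := 'surj_h_ Sz; exists j; rewrite jz; move: xz; rewrite -ball_normE.
Qed.

End BochnerExpectation.

(** * Walks watched until they leave a ball *)

Section StoppedWalk.
Context (R : realType) (H : normedModType R) (ip : {dot H for @idfun R}).
Hypothesis ip_norm : forall f, ip f f = `|f| ^+ 2.
Context (n : nat) (x : R).

(** Defined by recursion, so that its value at time [m] is seen to depend only on
the terms of index below [m]. *)
Fixpoint stays_below (e : 'I_n -> H) (m : nat) : bool :=
  (if m is m'.+1 then stays_below e m' else true) && (`|prefix_sum e m| < x).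

Lemma stays_below_lt e m : stays_below e m -> `|prefix_sum e m| < x.
Proof. by case: m => [|m] /andP[]. Qed.

Lemma stays_below_le e m m' : (m' <= m)%N -> stays_below e m -> stays_below e m'.
Proof.
elim: m => [|m ih]; first by rewrite leqn0 => /eqP->.
by rewrite leq_eqVlt => /predU1P[->//|mm] /andP[/(ih mm)].
Qed.

(** The right-hand side dominates the squared norm of the walk stopped at its
first exit from the ball of radius [x]: while the walk stays inside, the squared
norm of the partial sum increases at each step by twice the inner product with
the new term plus the square of that term. *)
Lemma stopped_walk_sqr (e : 'I_n -> H) : 0 < x ->
  (~~ stays_below e n)%:R * x ^+ 2 <=
  \sum_(j < n) (stays_below e j)%:R * (2 * ip (prefix_sum e j) (e j)) +
  \sum_(j < n) `|e j| ^+ 2.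
Proof.
move=> x0.
pose F (j : 'I_n) := (stays_below e j)%:R *
  (2 * ip (prefix_sum e j) (e j) + `|e j| ^+ 2).
have main m : (m <= n)%N ->
    if stays_below e m then prefix_sum F m = `|prefix_sum e m| ^+ 2
    else x ^+ 2 <= prefix_sum F m.
  elim: m => [_|m ih mn]; first by rewrite /= !prefix_sum0 normr0 x0 expr0n.
  have := ih (ltnW mn); rewrite !(prefix_sumS _ (Ordinal mn))/=.
  have -> : F (Ordinal mn) = (stays_below e m)%:R * (2 * ip (prefix_sum e m)
    (e (Ordinal mn)) + `|e (Ordinal mn)| ^+ 2) by [].
  case: (stays_below e m) => /=; last by rewrite mul0r addr0.
  move=> ->; rewrite mul1r (prefix_sumS e (Ordinal mn))/=.
  have -> : `|prefix_sum e m| ^+ 2 + (2 * ip (prefix_sum e m) (e (Ordinal mn)) +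
     `|e (Ordinal mn)| ^+ 2) = `|prefix_sum e m + e (Ordinal mn)| ^+ 2.
    by rewrite (normD_sqr ip_norm) addrA.
  by case: ltP => // h; rewrite ler_pXn2r ?nnegrE ?(ltW x0).
apply: (@le_trans _ _ (\sum_j F j)).
  have := main n (leqnn n); rewrite prefix_sum_all.
  by case: stays_below => [->|h]; rewrite ?mul0r ?exprn_ge0 ?mul1r.
rewrite -big_split/=; apply: ler_sum => j _.
by rewrite /F mulrDr lerD2l; case: stays_below; rewrite ?mul1r// mul0r exprn_ge0.
Qed.

End StoppedWalk.

(** * Measurability in the reproducing kernel Hilbert space *)

Section FeatureMeasurability.
Context (R : realType) d' (U : measurableType d') (k : U -> U -> R).
Hypothesis k_measurable : measurable_fun [set: U * U] (fun p => k p.1 p.2).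
Context (H : completeNormedModType R) (ip : {dot H for @idfun R}).
Context (ev : H -> U -> R) (Phi : U -> H).
Hypothesis H_rkhs : is_rkhs k ip ev Phi.

Let ip_norm := rkhs_norm H_rkhs.

Lemma rkhs_kernelE x z : k x z = ip (Phi x) (Phi z).
Proof.
by rewrite -(rkhs_feature H_rkhs) (rkhs_reproducing H_rkhs) ipC.
Qed.

Lemma norm_feature x : `|Phi x| = Num.sqrt (k x x).
Proof. by rewrite rkhs_kernelE ip_norm sqrtr_sqr normr_id. Qed.

(** The elements [h] for which this holds form a closed subspace, as a pointwise
limit of measurable functions is measurable.  It contains the features, so that a
vector orthogonal to it vanishes at every point as a function, hence is zero. *)
Lemma measurable_feature_ip h : measurable_fun setT (fun x => ip h (Phi x)).
Proof.
pose M : set H := [set h | measurable_fun setT (fun x => ip h (Phi x))].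
have M0 : M 0 by rewrite /M/=; under eq_fun do rewrite ip0l; exact: measurable_cst.
have Mlin a u v : M u -> M v -> M (a *: u + v).
  rewrite /M/= => mu mv; under eq_fun do rewrite ipDl ipZl.
  by apply: measurable_funD => //; apply: measurable_funM.
have Mlim (s : nat -> H) l : (forall j, M (s j)) -> s @ \oo --> l -> M l.
  move=> Ms sl; apply: (measurable_fun_cvg (h := fun j x => ip (s j) (Phi x))) => // x _.
  have : (fun j => `|l - s j| * `|Phi x|) @ \oo --> 0 * `|Phi x|.
    apply: cvgMr_tmp; rewrite -(normr0 H) -(subrr l).
    by apply: cvg_norm; apply: cvgB => //; exact: cvg_cst.
  rewrite mul0r => /cvgrPdist_lt cv; apply/cvgrPdist_lt => e /cv.
  apply: filterS => j; rewrite sub0r normrN ger0_norm ?mulr_ge0//.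
  by apply: le_lt_trans; rewrite -ipBl ip_cauchy_schwarz.
have [w Mw worth] := orthogonal_projection ip_norm M0 Mlin Mlim h.
suff -> : h = w by [].
apply: (rkhs_inj H_rkhs); apply/funext => x; rewrite !(rkhs_reproducing H_rkhs).
apply/eqP; rewrite -subr_eq0 -ipBl; apply/eqP; apply: worth; rewrite /M/=.
under eq_fun do rewrite -rkhs_kernelE.
exact: (measurable_fun_pair2 x k_measurable).
Qed.

Section Composed.
Context d (T : measurableType d).
Implicit Types (f g : T -> U).

Lemma measurable_ip_feature f h : measurable_fun setT f ->
  measurable_fun setT (fun w => ip (Phi (f w)) h).
Proof.
move=> mf; under eq_fun do rewrite ipC.
exact: measurableT_comp (measurable_feature_ip h) mf.
Qed.

Lemma measurable_ip_centered f g a b : measurable_fun setT f -> measurable_fun setT g ->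
  measurable_fun setT (fun w => ip (Phi (f w) - a) (Phi (g w) - b)).
Proof.
move=> mf mg.
under eq_fun do rewrite ipBl !ipBr -rkhs_kernelE (ipC ip a (Phi _)).
apply: measurable_funB; apply: measurable_funB => //; try exact: measurable_ip_feature.
exact: measurableT_comp k_measurable (measurable_fun_pair mf mg).
Qed.

Lemma measurable_norm_sqr (F : T -> H) :
  measurable_fun setT (fun w => ip (F w) (F w)) -> measurable_fun setT (fun w => `|F w|).
Proof.
move=> mF; rewrite (_ : (fun w => _) = Num.sqrt \o (fun w => ip (F w) (F w))).
  apply: measurableT_comp => //; apply: continuous_measurable_fun.
  exact: sqrt_continuous.
by apply/funext => w /=; rewrite ip_norm sqrtr_sqr normr_id.
Qed.

Lemma measurable_feature_dist f h : measurable_fun setT f ->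
  measurable_fun setT (fun w => `|Phi (f w) - h|).
Proof. by move=> mf; apply: measurable_norm_sqr; exact: measurable_ip_centered. Qed.

Lemma measurable_stays_below n (X : 'I_n -> T -> U) (mu : 'I_n -> H) x m :
  (forall i : 'I_n, (i < m)%N -> measurable_fun setT (X i)) ->
  measurable_fun setT (fun w => stays_below x (fun i => Phi (X i w) - mu i) m).
Proof.
move=> mX.
have mS m' : (m' <= m)%N ->
    measurable_fun setT (fun w => `|prefix_sum (fun i => Phi (X i w) - mu i) m'| < x).
  move=> mm; apply: measurable_fun_ltr; last exact: measurable_cst.
  apply: measurable_norm_sqr; rewrite /prefix_sum.
  under eq_fun do rewrite ip_suml.
  under eq_fun do rewrite big_mkcond.
  apply: measurable_sum => i; case im : (i < m')%N; last exact: measurable_cst.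
  under eq_fun do rewrite ip_sumr big_mkcond.
  apply: measurable_sum => j; case jm : (j < m')%N; last exact: measurable_cst.
  by apply: measurable_ip_centered; apply: mX; exact: leq_trans mm.
elim: m {mX} mS => [|m ih] mS; first exact: mS.
by apply: measurable_and; [apply: ih => m' mm; apply: mS; exact: leqW|exact: mS].
Qed.

End Composed.
End FeatureMeasurability.

(** * Independence of a variable from its past *)

Section Decoupling.
Context d (T : measurableType d) (R : realType) (P : probability T R).
Context d' (U : measurableType d').
Context (G : set (set T)) (Z : {mfun T >-> U}).
Hypothesis Gm : G `<=` measurable.
Hypothesis GI : setI_closed G.
Hypothesis GT : G setT.
Hypothesis GZ : forall A B, G A -> measurable B ->
  P (A `&` Z @^-1` B) = (P A * P (Z @^-1` B))%E.

Local Notation TG := (g_sigma_algebraType G).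

Let sGm : <<s G >> `<=` @measurable _ T.
Proof. exact: smallest_sub (@sigma_algebra_measurable _ T) Gm. Qed.

(** Both sides are finite measures in [A] that agree on the pi-system [G]. *)
Lemma independent_of_generated A B : <<s G >> A -> measurable B ->
  P (A `&` Z @^-1` B) = (P A * P (Z @^-1` B))%E.
Proof.
move=> sA mB; have mZB : measurable (Z @^-1` B) by exact: measurable_funPTI.
pose r := NngNum (fine_ge0 (measure_ge0 P (Z @^-1` B))).
have rE : (r%:num%:E)%E = P (Z @^-1` B) by rewrite /= fineK// fin_num_measure.
rewrite muleC -rE.
apply: (@g_sigma_algebra_measure_unique _ _ T G Gm (fun=> setT) (fun=> GT) _
  (mrestr P mZB) (mscale r P) GI _ _ A sA).
- by rewrite bigcup_const//; exists 0%N.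
- move=> A' GA'; apply: (etrans (GZ GA' mB)); rewrite muleC -rE; exact: erefl.
- move=> _; change (P (setT `&` Z @^-1` B) < +oo)%E.
  by rewrite setTI (le_lt_trans (probability_le1 _ _))// ltry.
Qed.

(** The joint law of the identity, into the underlying set endowed with the
sigma-algebra generated by [G], and of [Z] is the product of the two laws.  Hence
the integral is an iterated one, in which the first argument of [F] is frozen
while [Z] is averaged. *)
Lemma decoupled_integral_eq0 (F : TG * U -> R) (g : U -> R) :
  measurable_fun setT F ->
  (forall w u, `|F (w, u)| <= g u) -> integ P (g \o Z) ->
  (forall w, \int[P]_w' F (w, Z w') = 0) ->
  \int[P]_w F (w, Z w) = 0.
Proof.
move=> mF Fg ig F0.
have mid : measurable_fun [set: T] (id : T -> TG).
  by move=> _ B mB; rewrite setTI; exact: sGm.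
pose idG : {mfun T >-> TG} :=
  HB.pack (id : T -> TG) (isMeasurableFun.Build _ _ _ _ _ mid).
have mpair : measurable_fun [set: T] (fun w => (w, Z w) : TG * U).
  by apply: measurable_fun_pair.
pose pairG : {mfun T >-> (TG * U)%type} :=
  HB.pack (fun w => (w, Z w) : TG * U) (isMeasurableFun.Build _ _ _ _ _ mpair).
have iF : integ P (fun w => F (w, Z w)).
  by apply: (integ_le _ _ ig) => [|w /=]; [exact: measurableT_comp mF mpair|exact: Fg].
have iF1 w : integ P (fun w' => F (w, Z w')).
  apply: (integ_le _ _ ig) => [|w' /=]; last exact: Fg.
  exact: measurableT_comp (measurable_fun_pair2 w mF) _.
have prodE : forall S, measurable S ->
    (distribution P idG \x distribution P Z)%E S = distribution P pairG S.
  apply: product_measure_unique => A B mA mB.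
  exact: (independent_of_generated mA mB).
have mFE : measurable_fun setT (EFin \o F) by exact/measurable_EFinP.
have Fprod : (distribution P idG \x distribution P Z)%E.-integrable setT (EFin \o F).
  apply/integrableP; split => //.
  rewrite (eq_measure_integral (distribution P pairG)); last first.
    by move=> S mS _; exact: prodE.
  rewrite ge0_integral_distribution//; last exact: measurableT_comp.
  by have /integrableP[_] := iF.
rewrite /Rintegral.
have -> : (\int[P]_w (F (w, Z w))%:E)%E =
    (\int[distribution P pairG]_z (EFin \o F) z)%E.
  rewrite integral_distribution//.
rewrite -(eq_measure_integral (distribution P pairG) (fun S mS _ => prodE S mS)).
rewrite -integral12_prod_meas1//.
rewrite integral0_eq// => w _; rewrite /fubini_F.
rewrite (_ : (fun y => _) = (fun y => (F (w, y))%:E))//.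
have mFw : measurable_fun setT (fun y => (F (w, y))%:E).
  by apply/measurable_EFinP; exact: measurable_fun_pair2.
rewrite integral_distribution//; last exact: iF1.
rewrite -[LHS]fineK; last exact: integrable_fin_num (iF1 w).
by rewrite -[X in X%:E]/(\int[P]_w' F (w, Z w')) F0.
Qed.

End Decoupling.

Section Past.
Context (R : realType) (n : nat) d (T : measurableType d) (P : probability T R).
Context d' (U : measurableType d') (X : 'I_n -> {mfun T >-> U}).
Hypothesis X_indep : independent_variables P X.

(** A pi-system generating the sigma-algebra of the variables of index below [j]. *)
Definition past_events (j : nat) : set (set T) :=
  [set \bigcap_(i in [set` [set i : 'I_n | (i < j)%N]%SET]) (X i @^-1` B i) |
     B in [set B : 'I_n -> set U | forall i, measurable (B i)]].

Lemma past_events_measurable j : past_events j `<=` measurable.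
Proof.
move=> _ [B mB <-]; apply: fin_bigcap_measurable => // i _.
exact: measurable_funPTI.
Qed.

Lemma past_eventsI j : setI_closed (past_events j).
Proof.
move=> _ _ [B mB <-] [C mC <-]; exists (fun i => B i `&` C i).
  by move=> i /=; exact: measurableI.
by rewrite -bigcapI; apply: eq_bigcapr => i _; rewrite preimage_setI.
Qed.

Lemma past_eventsT j : past_events j setT.
Proof.
exists (fun=> setT) => //=; apply/seteqP; split => // w _ i _; exact: I.
Qed.

Lemma past_events_preimage (j : nat) (i : 'I_n) (C : set U) : (i < j)%N ->
  measurable C -> past_events j (X i @^-1` C).
Proof.
move=> ij mC; exists (fun i' => if i' == i then C else setT).
  by move=> i' /=; case: ifP.
apply/seteqP; split => w /=.
  by move=> /(_ i); rewrite eqxx; apply; rewrite /= inE.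
by move=> Cw i' _ /=; case: eqP => // ->.
Qed.

(** Adjoining the event on [X j] to the finite family gives another instance of
the product rule. *)
Lemma past_events_indep (j : 'I_n) A B : past_events j A -> measurable B ->
  P (A `&` X j @^-1` B) = (P A * P (X j @^-1` B))%E.
Proof.
move=> [C mC <-] mB; pose J := [set i : 'I_n | (i < j)%N]%SET.
pose C' i := if i == j then B else C i.
have jJ : j \notin J by rewrite inE ltnn.
have CC i : i \in J -> C' i = C i.
  by move=> iJ; rewrite /C'; case: eqP => // ij; move: jJ; rewrite -ij iJ.
have mC' i : measurable (C' i) by rewrite /C'; case: ifP.
have C'j : C' j = B by rewrite /C' eqxx.
have -> : \bigcap_(i in [set` J]) (X i @^-1` C i) `&` X j @^-1` B =
    \bigcap_(i in [set` (j |: J)%SET]) (X i @^-1` C' i).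
  apply/seteqP; split => w /=.
    move=> [h Bw] i /=; rewrite in_setU1 => /predU1P[->|iJ]; first by rewrite C'j.
    by rewrite CC//; exact: h.
  move=> h; split.
    by move=> i iJ /=; have := h i; rewrite CC//; apply; rewrite /= in_setU1 iJ orbT.
  by have := h j; rewrite C'j; apply; rewrite /= setU11.
rewrite X_indep// big_setU1//= C'j muleC X_indep//; congr (_ * _)%E.
by apply: eq_bigr => i iJ; rewrite CC.
Qed.

Lemma measurable_past (j : nat) (i : 'I_n) : (i < j)%N ->
  measurable_fun [set: g_sigma_algebraType (past_events j)] (X i).
Proof.
move=> ij _ C mC; rewrite setTI; apply: sub_sigma_algebra.
exact: past_events_preimage.
Qed.

End Past.

(** * Kolmogorov's maximal inequality *)

Section MaximalInequality.
Context (R : realType) (n : nat) d (T : measurableType d) (P : probability T R).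
Context d' (U : measurableType d') (X : 'I_n -> {mfun T >-> U}).
Hypothesis X_indep : independent_variables P X.
Context (k : U -> U -> R).
Hypothesis k_measurable : measurable_fun [set: U * U] (fun p => k p.1 p.2).
Context (H : completeNormedModType R) (ip : {dot H for @idfun R}).
Context (ev : H -> U -> R) (Phi : U -> H).
Hypothesis H_rkhs : is_rkhs k ip ev Phi.
Context (mu : 'I_n -> H).
Hypothesis feature_integ : forall i, integ P (fun w => `|Phi (X i w)|).
Hypothesis mu_mean : forall i f, ip (mu i) f = \int[P]_w ip (Phi (X i w)) f.

Let ip_norm := rkhs_norm H_rkhs.
Let eps w i := Phi (X i w) - mu i.

Let mX i : measurable_fun setT (X i). Proof. exact: measurable_funPT. Qed.

Lemma measurable_noise i : measurable_fun setT (fun w => `|eps w i|).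
Proof. exact: (measurable_feature_dist k_measurable H_rkhs). Qed.

Lemma integ_noise i : integ P (fun w => `|eps w i|).
Proof.
apply: (integ_le (g := fun w => `|Phi (X i w)| + `|mu i|)).
- exact: measurable_noise.
- by move=> w; rewrite normr_id ler_normB.
- by apply: integD => //; exact: integ_cst.
Qed.

Lemma mean_noise i f : \int[P]_w ip f (eps w i) = 0.
Proof.
under eq_Rintegral do rewrite ipC ipBl.
rewrite RintegralB//; last exact: integ_cst.
  by rewrite -mu_mean Rintegral_cst// (congr1 fine (probability_setT P)) mulr1 subrr.
apply: (integ_ip ip_norm) => // h.
exact: (measurable_ip_feature k_measurable H_rkhs).
Qed.

(** The walk before time [j], cut off when it has left the ball, is a bounded
function of the past, and the noise at time [j] is orthogonal in mean to any fixed
vector.  The cut-off makes the integrand dominated by [x * `|eps w j|]. *)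
Lemma stopped_increment_mean (x : R) (j : 'I_n) : 0 < x ->
  integ P (fun w => (stays_below x (eps w) j)%:R * ip (prefix_sum (eps w) j) (eps w j)) /\
  \int[P]_w ((stays_below x (eps w) j)%:R * ip (prefix_sum (eps w) j) (eps w j)) = 0.
Proof.
move=> x0.
pose TG := g_sigma_algebraType (past_events X j).
pose F (p : TG * U) : R := (stays_below x (eps p.1) j)%:R *
  ip (prefix_sum (eps p.1) j) (Phi p.2 - mu j).
have Fbound w u : `|F (w, u)| <= x * `|Phi u - mu j|.
  rewrite /F normrM /=; case sb : stays_below; last first.
    by rewrite normr0 mul0r mulr_ge0// ltW.
  rewrite normr1 mul1r (le_trans (ip_cauchy_schwarz ip_norm _ _))//.
  by rewrite ler_wpM2r// ltW// stays_below_lt.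
have integ_bound : integ P ((fun u => x * `|Phi u - mu j|) \o X j).
  by apply: (integZ x); exact: integ_noise.
(* Used twice: on the original space, and on the product of the past with the
   state space, where the last variable is a separate coordinate. *)
have mF d0 (T0 : measurableType d0) (Z : 'I_n -> T0 -> U) (z : T0 -> U) :
    (forall i : 'I_n, (i < j)%N -> measurable_fun setT (Z i)) ->
    measurable_fun setT z ->
    measurable_fun setT (fun p => (stays_below x (fun i => Phi (Z i p) - mu i) j)%:R *
      ip (prefix_sum (fun i => Phi (Z i p) - mu i) j) (Phi (z p) - mu j)).
  move=> mZ mz; apply: measurable_funM.
    rewrite (_ : (fun p => _) = (fun p =>
      if stays_below x (fun i => Phi (Z i p) - mu i) j then 1 else 0)); last first.
      by apply/funext => p; case: ifP.
    apply: measurable_fun_ifT; try exact: measurable_cst.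
    exact: (measurable_stays_below k_measurable H_rkhs).
  under eq_fun do rewrite /prefix_sum ip_suml big_mkcond.
  apply: measurable_sum => i; case ij : (i < j)%N; last exact: measurable_cst.
  by apply: (measurable_ip_centered k_measurable H_rkhs) => //; exact: mZ.
split.
  by apply: (integ_le _ _ integ_bound) => [|w]; [exact: (mF _ T X (X j))|exact: Fbound].
apply: (@decoupled_integral_eq0 _ _ _ P _ U (past_events X j) (X j) _ _ _ _ F
  (fun u => x * `|Phi u - mu j|)) => //.
- exact: past_events_measurable.
- exact: past_eventsI.
- exact: past_eventsT.
- by move=> A B GA mB; exact: past_events_indep.
- apply: (mF _ (TG * U)%type (fun i p => X i p.1) (fun p => p.2)).
    move=> i ij; have mp := measurable_past (X := X) ij.
    exact: (measurableT_comp mp measurable_fst).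
  exact: measurable_snd.
- move=> w; rewrite /F/=; set f := prefix_sum _ _.
  rewrite RintegralZl//; first by rewrite mean_noise mulr0.
  apply: (integ_le (g := fun w' => `|f| * `|eps w' j|)).
  + under eq_fun do rewrite ipC ipBl.
    apply: measurable_funB; last exact: measurable_cst.
    exact: (measurable_ip_feature k_measurable H_rkhs).
  + by move=> w'; exact: ip_cauchy_schwarz.
  + by apply: integZ; exact: integ_noise.
Qed.

(** Integrating [stopped_walk_sqr], whose inner product terms have mean zero. *)
Lemma kolmogorov_maximal (V x : R) : 0 < x ->
  (forall i, (\int[P]_w (`|eps w i| ^+ 2)%:E <= V%:E)%E) ->
  let A := [set w | stays_below x (eps w) n] in
  measurable A /\ (P (~` A) <= (n%:R * V / x ^+ 2)%:E)%E.
Proof.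
move=> x0 epsV A.
have mA : measurable A.
  have := @measurable_stays_below _ _ _ _ k_measurable _ _ _ _ H_rkhs _ T n X mu x n.
  move=> /(_ (fun i _ => mX i) measurableT [set true]); rewrite setTI.
  by apply.
split => //.
have msqr i : measurable_fun setT (fun w => `|eps w i| ^+ 2).
  by apply: measurable_funX; exact: measurable_noise.
have isqr i : integ P (fun w => `|eps w i| ^+ 2).
  apply/integrableP; split; first exact/measurable_EFinP.
  under eq_integral do rewrite gee0_abs ?lee_fin ?exprn_ge0//.
  by apply: le_lt_trans (epsV i) _; rewrite ltry.
have Vsqr i : \int[P]_w (`|eps w i| ^+ 2) <= V.
  by rewrite -lee_fin fineK ?epsV//; exact: integrable_fin_num (isqr i).
have iinc j := (stopped_increment_mean j x0).1.
have inc0 j := (stopped_increment_mean j x0).2.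
have iinc2 (j : 'I_n) : integ P (fun w => (stays_below x (eps w) j)%:R *
    (2 * ip (prefix_sum (eps w) j) (eps w j))).
  under [X in _ \o X]eq_fun do rewrite mulrCA.
  exact: integZ.
have key : x ^+ 2 * fine (P (~` A)) <= n%:R * V.
  rewrite mulrC -Rintegral_indicM; last exact: measurableC.
  apply: (@le_trans _ _ (\int[P]_w
    (\sum_(j < n) (stays_below x (eps w) j)%:R * (2 * ip (prefix_sum (eps w) j) (eps w j))
      + \sum_(j < n) `|eps w j| ^+ 2))).
    apply: le_Rintegral => //.
    - by apply: integ_indicM; [exact: measurableC|exact: integ_cst].
    - by apply: integD; apply: integ_sum.
    - move=> w _; rewrite indicE in_setC; suff -> : (w \in A) = stays_below x (eps w) n.
        exact: stopped_walk_sqr.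
      by apply/idP/idP; rewrite inE.
  rewrite RintegralD//; [|exact: integ_sum|exact: integ_sum].
  rewrite !Rintegral_sum// big1 ?add0r; last first.
    move=> j _; under eq_Rintegral do rewrite mulrCA.
    by rewrite RintegralZl// inc0 mulr0.
  apply: le_trans (ler_sum _ (fun i _ => Vsqr i)) _.
  by rewrite sumr_const card_ord mulr_natl.
rewrite -[leLHS]fineK ?fin_num_measure//; last exact: measurableC.
by rewrite lee_fin ler_pdivlMr ?exprn_gt0// mulrC.
Qed.

End MaximalInequality.

(** * Localization with high probability *)

Theorem theorem3p2 (R : realType) (n : nat) (n_ge2 : (2 <= n)%N)
  (d : measure_display) (T : measurableType d) (P : probability T R)
  (d' : measure_display) (U : measurableType d')
  (X : 'I_n -> {mfun T >-> U}) (X_indep : independent_variables P X)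
  (k : U -> U -> R)
  (k_measurable : measurable_fun [set: U * U] (fun p => k p.1 p.2))
  (k_sym : kernel_symmetric k) (k_psd : kernel_psd k)
  (H : completeNormedModType R) (ip : {dot H for @idfun R})
  (ev : H -> U -> R) (Phi : U -> H) (H_rkhs : is_rkhs k ip ev Phi)
  (H_separable : separable_space H)
  (k_moment : forall i,
     ('E_P[(fun w => Num.sqrt (k (X i w) (X i w)))%R] < +oo)%E) :
  let Y := fun (i : 'I_n) (w : T) => Phi (X i w) in
  let mu := fun i : 'I_n => bochner_expectation P (Y i) in
  let eps := fun (i : 'I_n) (w : T) => Y i w - mu i in
  forall (taustar : segmentation n) (V : R),
  is_true_segmentation mu taustar ->
  0 < V ->
  (forall i, ('E_P[(fun w => `|eps i w| ^+ 2)%R] <= V%:E)%E) ->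
  (2 <= nseg taustar)%N ->
  forall y : R, 0 < y ->
  exists2 Omega2 : set T,
    measurable Omega2 /\ ((1 - 1 / y ^+ 2)%:E <= P Omega2)%E &
    forall w, Omega2 w ->
    forall (delta : R) (tauhat : segmentation n),
      0 < delta -> delta <= Lambda_min R taustar ->
      is_argmin
        [set t | nseg t = nseg taustar /\ delta <= Lambda_min R t]
        (empirical_risk k (fun i => X i w)) tauhat ->
      v2 mu (nseg taustar) V y delta <= Lambda_min R taustar ->
      (d_infty1 taustar tauhat)%:R / n%:R
        <= v2 mu (nseg taustar) V y delta.
Proof.
move=> Y mu eps taustar V mut V0 epsV t2 y y0.
have ip_norm := rkhs_norm H_rkhs.
have n0 : 0 < n%:R :> R by rewrite ltr0n ltnW.
have mX i : measurable_fun setT (X i) by exact: measurable_funPT.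
have feature_integ i : integ P (fun w => `|Y i w|).
  apply/integrableP; split.
    apply/measurable_EFinP; under eq_fun do rewrite -[Y i _]subr0.
    exact: (measurable_feature_dist k_measurable H_rkhs).
  have := k_moment i; rewrite unlock; under eq_integral do rewrite -(norm_feature H_rkhs).
  by under [in X in _ -> X]eq_integral do rewrite /= normr_id.
have mu_mean i f : ip (mu i) f = \int[P]_w ip (Y i w) f.
  apply: (bochner_expectation_pairing ip_norm) => // h.
    exact: (measurable_feature_dist k_measurable H_rkhs).
  exact: (measurable_ip_feature k_measurable H_rkhs).
pose x := y * Num.sqrt (n%:R * V).
have x0 : 0 < x by rewrite mulr_gt0// sqrtr_gt0 mulr_gt0.
have epsV' i : (\int[P]_w (`|Phi (X i w) - mu i| ^+ 2)%:E <= V%:E)%E.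
  by have := epsV i; rewrite unlock.
have := kolmogorov_maximal X_indep k_measurable H_rkhs feature_integ mu_mean x0 epsV'.
set Omega2 := [set w | _] => -[mO PO]; exists Omega2.
  split=> //; rewrite -(setCK Omega2) probability_setC; last exact: measurableC.
  rewrite EFinB leeB//; apply: le_trans PO _; rewrite lee_fin.
  (* The factor [n * V] cancels in Kolmogorov's bound. *)
  rewrite /x exprMn sqr_sqrtr; last by rewrite mulr_ge0// ltW.
  by rewrite invfM mulrCA divff ?mulr1 ?div1r// mulf_neq0 ?gt_eqF.
move=> w Ow delta tauhat d0 dL [[sizeE dLhat] best] v2L.
apply: (change_point_localization ip_norm (e := fun i => eps i w)) => //.
  by move=> m mn; apply/ltW/stays_below_lt; apply: stays_below_le mn Ow.
(* The remaining goal compares energies; the risk is a constant minus a multiple. *)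
have -> : (fun i => mu i + eps i w) = (fun i => Phi (X i w)).
  by apply/funext => i; rewrite /eps addrC subrK.
have := best taustar (conj erefl dL).
rewrite !(empirical_riskE _ _ (rkhs_kernelE H_rkhs)).
by rewrite lerD2l lerN2 ler_pM2l// invr_gt0.
Qed.
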